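(* Let $(X,\mathcal{B},\mu,T)$ be a non-atomic ergodic measure-preserving dynamical system. Then there exists a dense $G_\delta$ subset $\mathcal{R}\subseteq\mathcal{B}$ such that for every $A\in\mathcal{R}$, for $\mu$-almost every $x\in X$, $$\limsup_{N\to\infty}\frac1N\sum_{n=1}^N 1_A(T^{\Omega(n)}x)=1\qquad\text{and}\qquad \liminf_{N\to\infty}\frac1N\sum_{n=1}^N 1_A(T^{\Omega(n)}x)=0,$$ where $1_A$ denotes the indicator function of $A$.
   Context: For $n\in\mathbb{N}=\{1,2,\dots\}$, $\Omega(n)$ denotes the number of prime factors of $n$ counted with multiplicity (so $\Omega(1)=0$). A measure-preserving dynamical system $(X,\mathcal{B},\mu,T)$ consists of a compact metric space $X$, its Borel $\sigma$-algebra $\mathcal{B}$, a Borel probability measure $\mu$, and a measurable map $T:X\to X$ with $\mu(T^{-1}A)=\mu(A)$ for all $A\in\mathcal{B}$. It is ergodic if every $A\in\mathcal{B}$ with $T^{-1}A=A$ has $\mu(A)\in\{0,1\}$. It is non-atomic if $\mu$ has no atoms. The topology on $\mathcal{B}$ is the one given by the (pseudo)metric $d(A,B)=\mu(A\,\triangle\,B)$, sets being identified when they differ by a $\mu$-null set. *)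

(* Defs.v *)
(* MathComp-Analysis *)
From HB Require Import structures.
From mathcomp Require Import all_boot all_order all_algebra.
From mathcomp Require Import all_classical all_reals all_analysis.

Set Implicit Arguments.
Unset Strict Implicit.
Unset Printing Implicit Defensive.

Import Order.TTheory GRing.Theory Num.Theory.
Import numFieldNormedType.Exports.

Local Open Scope classical_set_scope.
Local Open Scope ring_scope.

(* Measurable types are pointed in the library; a space carrying a probability
   measure is nonempty, so asking for a base point loses nothing. *)
#[short(type="pmetricType")]
HB.structure Definition PointedMetric (R : numDomainType) :=
  {T of Pointed T & Metric R T}.

Definition borel (R : realType) (X : pmetricType R) :=
  g_sigma_algebraType (@open X).

Section Dynamics.
Context d (X : measurableType d) (R : realType) (mu : probability X R).

Definition measure_preserving (T : X -> X) : Prop :=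
  measurable_fun setT T /\
  forall A, measurable A -> mu (T @^-1` A) = mu A.

Definition ergodic (T : X -> X) : Prop :=
  forall A, measurable A -> T @^-1` A = A -> mu A = 0%E \/ mu A = 1%E.

Definition atom (A : set X) : Prop :=
  [/\ measurable A, (0 < mu A)%E &
      forall B, measurable B -> B `<=` A -> mu B = 0%E \/ mu B = mu A].

Definition non_atomic : Prop := ~ exists A, atom A.

End Dynamics.

(* The measurable sets, with the topology of the pseudometric mu (A `+` B).
   Null sets are not quotiented out: an open set contains, with A, every
   measurable set differing from A by a null set, so the open, dense and
   G_delta subsets here are exactly the preimages of those of the quotient. *)
Definition measurable_sets d (X : measurableType d) (R : realType)
  (mu : probability X R) : Type := set_type (@measurable d X).

Section MeasurableSets.
Context d (X : measurableType d) (R : realType) (mu : probability X R).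
Local Notation M := (measurable_sets mu).

Definition mset_val (A : M) : set X := set_val A.

Definition symdiff_dist (A B : M) : R :=
  fine (mu (mset_val A `+` mset_val B)).

Lemma mset_valP (A : M) : measurable (mset_val A).
Proof. exact: (set_valP A). Qed.

Let measurableY (A B : M) : measurable (mset_val A `+` mset_val B).
Proof.
by rewrite setY_def; apply: measurableU; apply: measurableD;
  exact: mset_valP.
Qed.

Lemma symdiff_distE (A B : M) :
  (symdiff_dist A B)%:E = mu (mset_val A `+` mset_val B).
Proof. by rewrite fineK// fin_num_measure. Qed.

Lemma symdiff_distxx (A : M) : symdiff_dist A A = 0.
Proof. by rewrite /symdiff_dist setYK measure0. Qed.

Lemma symdiff_distC (A B : M) : symdiff_dist A B = symdiff_dist B A.
Proof. by rewrite /symdiff_dist setYC. Qed.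

Lemma symdiff_dist_triangle (B A C : M) :
  symdiff_dist A C <= symdiff_dist A B + symdiff_dist B C.
Proof.
rewrite -lee_fin EFinD !symdiff_distE.
apply: (le_trans _ (measureU2 _ _ _)); [|exact: measurableY..].
apply: le_measure; rewrite ?inE; [exact: measurableY|by apply: measurableU|].
rewrite !setY_def => x /=.
by have [xB|xB] := pselect (mset_val B x); tauto.
Qed.

HB.instance Definition _ := gen_eqMixin M.
HB.instance Definition _ := gen_choiceMixin M.

Let mball (A : M) (e : R) : set M := [set B | symdiff_dist A B < e].

Let ent : set_system (M * M) := entourage_ mball.

Let mnbhs (A : M) : set_system M := nbhs_ ent A.

HB.instance Definition _ := hasNbhs.Build M mnbhs.

Let mnbhsE : (nbhs : M -> _) = nbhs_ ent. Proof. by []. Qed.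

Let mball_center (A : M) (e : R) : 0 < e -> mball A e A.
Proof. by move=> e0; rewrite /mball/= symdiff_distxx. Qed.

Let mball_sym (A B : M) (e : R) : mball A e B -> mball B e A.
Proof. by rewrite /mball/= symdiff_distC. Qed.

Let mball_triangle (A B C : M) (e1 e2 : R) :
  mball A e1 B -> mball B e2 C -> mball A (e1 + e2) C.
Proof.
rewrite /mball/= => AB BC.
by rewrite (le_lt_trans (symdiff_dist_triangle B A C))// ltrD.
Qed.

Let entE : ent = entourage_ mball. Proof. by []. Qed.

HB.instance Definition _ := @Nbhs_isPseudoMetric.Build R M
  ent mnbhsE mball mball_center mball_sym mball_triangle entE.

Lemma mset_ballE (A : M) (e : R) : ball A e = [set B | symdiff_dist A B < e].
Proof. by []. Qed.

End MeasurableSets.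

Definition prime_Omega (n : nat) : nat :=
  (\sum_(p <- primes n) logn p n)%N.

(* The term of index N = 0 is 0. *)
Definition Omega_average (R : realType) (X : Type) (T : X -> X) (A : set X)
    (x : X) (N : nat) : R :=
  N%:R^-1 * \sum_(1 <= n < N.+1) \1_A (iter (prime_Omega n) T x).

(* Main.v *)
Require Import Defs.
From mathcomp Require Import all_boot all_order all_algebra.
From mathcomp Require Import all_classical all_reals all_analysis.
From mathcomp Require Import borel_hierarchy.
From mathcomp Require Import measurable_realfun ring lra zify.
Import Order.TTheory GRing.Theory Num.Theory.
Import numFieldNormedType.Exports.

Set Implicit Arguments.
Unset Strict Implicit.
Unset Printing Implicit Defensive.

Local Open Scope classical_set_scope.
Local Open Scope ring_scope.

(** For a fixed [N] the average only sees a short stretch of the orbit of [x].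
    Put h(N) = sum of 1/p over the primes p <= N. Turan's variance bound says
    that, for most n <= N, Omega(n) lies within a large multiple of sqrt (h(N))
    of h(N), so the average is decided by the points T^j x with j in a window
    around h(N) whose length is negligible compared with h(N). Since h is
    unbounded (Euler) and grows by at most 1 at each step, such windows exist
    at every height: for suitable L much smaller than M, and every m in
    [M, 2M), there is an N for which most n <= N have Omega(n) in [m, m + L)
    ([Omega_window]).

    A very small set can therefore trap the averages. Ergodicity gives a set F
    of measure at most 2/M that almost every orbit meets within M steps
    ([sweeping_base]). Let E be the set of points that enter F during the next
    L steps, so that mu E <= 2L/M. For almost every x there is m in [M, 2M)
    with T^(m + L) x in F; then T^j x is in E for all j in [m, m + L), and the
    average of the indicator of E at the corresponding N is close to 1
    ([Omega_trap]).

    Replacing A by its union with E, or by its difference with E, moves A by at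
    most mu E and brings averages of most points close to 1, respectively to 0,
    at some late time. Thus having such averages is a dense condition on A. It
    is also open, because only finitely many times are involved
    ([often_stable]). The pseudometric mu (A `+` B) is complete, so by Baire's theorem
    the sets that satisfy all these conditions are dense
    ([measurable_sets_Baire]), and for them the upper limit is 1 and the lower
    limit is 0 almost everywhere ([often_ae]). *)

(** * The sum of the reciprocals of the primes *)

Definition prime_reciprocals (R : realType) (N : nat) : R :=
  \sum_(1 <= p < N.+1 | prime p) p%:R^-1.

Lemma sum_multiples (V : nmodType) (q N : nat) (F : nat -> V) : (0 < q)%N ->
  \sum_(1 <= n < N.+1 | (q %| n)%N) F n =
  \sum_(1 <= m < (N %/ q).+1) F (q * m)%N.
Proof.
move=> q0; elim: N => [|N IH]; first by rewrite div0n !big_geq.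
rewrite big_mkcond big_nat_recr//= -big_mkcond IH divnS//.
case: ifPn => [qN|_] /=; last by rewrite addr0 add0n.
rewrite add1n [RHS]big_nat_recr//=; congr (_ + F _).
by rewrite -[LHS](divnK qN) divnS// qN add1n mulnC.
Qed.

Definition smooth (K n : nat) : bool := all (leq^~ K) (primes n).

Definition smooth_harmonic (R : realType) (K N : nat) : R :=
  \sum_(1 <= n < N.+1 | smooth K n) n%:R^-1.

Lemma smoothS_nprime K n : ~~ prime K.+1 -> smooth K.+1 n = smooth K n.
Proof.
move=> nK; apply/allP/allP => S p pn; have := S p pn; last exact: leqW.
rewrite leq_eqVlt => /orP[/eqP pK|//].
by move: pn nK; rewrite mem_primes pK => /and3P[->].
Qed.

Lemma smoothS_prime K n : (0 < n)%N -> prime K.+1 ->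
  smooth K.+1 n && ~~ (K.+1 %| n)%N = smooth K n.
Proof.
move=> n0 pK; apply/andP/allP => [[/allP S Kn] p pn|S].
  have := S p pn; rewrite leq_eqVlt => /orP[/eqP pE|//].
  by move: pn Kn; rewrite mem_primes pE => /and3P[_ _ ->].
split; first by apply/allP => p /S; exact: leqW.
apply/negP => Kn; have := S K.+1; rewrite mem_primes pK n0 Kn => /(_ isT).
by rewrite ltnn.
Qed.

Lemma smoothM K m n : (0 < m)%N -> (0 < n)%N ->
  smooth K (m * n) -> smooth K n.
Proof.
move=> m0 n0 /allP S; apply/allP => p pn; apply: S.
by rewrite primesM// pn orbT.
Qed.

(** A factor of Euler's product. If q = K + 1 is prime, the multiples of q
    among the q-smooth numbers contribute at most 1/q times the whole sum H, so
    (1 - 1/q) H is at most the sum over the K-smooth numbers; and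
    1 <= (1 - 1/q) (1 + 2/q) as q >= 2. *)
Lemma smooth_harmonic_step (R : realType) K N :
  smooth_harmonic R K.+1 N <=
  (if prime K.+1 then expR (2 / K.+1%:R) else 1) * smooth_harmonic R K N.
Proof.
case: ifPn => [pK|nK]; last first.
  by rewrite mul1r /smooth_harmonic; under eq_bigl do rewrite smoothS_nprime//.
set q := K.+1 in pK *; set H := smooth_harmonic R q N.
have H0 : 0 <= H by apply: sumr_ge0 => n _; rewrite invr_ge0.
have q2 : 2 <= q%:R :> R by rewrite ler_nat prime_gt1.
have HE : H <= smooth_harmonic R K N + q%:R^-1 * H.
  rewrite {1}/H /smooth_harmonic (bigID (fun n => q %| n)%N)/= addrC lerD//.
    rewrite big_nat_cond [leRHS]big_nat_cond le_eqVlt; apply/orP; left.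
    apply/eqP; apply: eq_bigl => n; case: (boolP (1 <= n < N.+1)%N) => //=.
    by case/andP=> n0 _; rewrite smoothS_prime.
  under eq_bigl do rewrite andbC.
  rewrite big_mkcondr/= sum_multiples//.
  rewrite [leRHS]mulr_sumr [leRHS]big_mkcond/=.
  have Nq : ((N %/ q).+1 <= N.+1)%N by rewrite ltnS leq_div.
  rewrite [leRHS](@big_cat_nat _ _ _ _ _ _ _ _ _ Nq)//= -[leLHS]addr0 lerD//.
    rewrite big_nat [leRHS]big_nat ler_sum// => n /andP[n0 _].
    case: ifPn => [/smoothM->//|_]; first by rewrite natrM invfM.
    by case: ifP => // _; rewrite mulr_ge0// invr_ge0.
  by apply: sumr_ge0 => n _; case: ifP => // _; rewrite mulr_ge0// invr_ge0.
have S0 : 0 <= smooth_harmonic R K N by apply: sumr_ge0 => n _; rewrite invr_ge0.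
apply: (@le_trans _ _ ((1 + 2 / q%:R) * smooth_harmonic R K N)); last first.
  by rewrite ler_wpM2r// expR_ge1Dx.
set S := smooth_harmonic R K N in HE S0 *.
have i0 : 0 < q%:R^-1 :> R by rewrite invr_gt0; lra.
have i2 : q%:R^-1 <= 2^-1 :> R by rewrite lef_pV2 ?posrE//; lra.
set i := q%:R^-1 in HE i0 i2 *.
have := mulr_ge0 (mulr_ge0 (ltW i0) H0) (_ : 0 <= 1 - 2 * i).
have : (1 + 2 * i) * (H - i * H) <= (1 + 2 * i) * S.
  by rewrite ler_pM2l; lra.
by move=> H1 H2; have := H2 ltac:(lra); lra.
Qed.

(** Every n <= N is N-smooth, so multiplying the factors for the primes up to N
    bounds the harmonic sum by an exponential of the sum over primes. *)
Lemma harmonic_le_expR (R : realType) N :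
  \sum_(1 <= n < N.+1) n%:R^-1 <= expR (2 * prime_reciprocals R N) :> R.
Proof.
have -> : \sum_(1 <= n < N.+1) n%:R^-1 = smooth_harmonic R N N.
  rewrite /smooth_harmonic big_nat_cond [RHS]big_nat_cond.
  apply: eq_bigl => n; case: (boolP (1 <= n < N.+1)%N) => //=.
  case/andP=> n0 nN; apply/esym/allP => p.
  rewrite mem_primes => /and3P[_ _ /dvdn_leq]/(_ n0) pn.
  by rewrite (leq_trans pn).
suff H K : smooth_harmonic R K N <= expR (2 * prime_reciprocals R K) by [].
elim: K => [|K IH].
  rewrite /prime_reciprocals big_geq// mulr0 expR0.
  rewrite /smooth_harmonic; case: N => [|N]; first by rewrite big_geq.
  rewrite big_mkcond big_nat_recl//= big1_seq ?addr0 ?invr1//.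
  move=> n; rewrite mem_index_iota => /andP[_ /andP[n0 _]]; case: ifP => // /allP S.
  have := S (pdiv n.+1); rewrite mem_primes pdiv_prime//= pdiv_dvd.
  by move=> /(_ isT); rewrite leqn0 => /eqP E; have := pdiv_gt0 n.+1; rewrite E.
apply: (le_trans (smooth_harmonic_step _ _ _)).
rewrite /prime_reciprocals big_mkcond big_nat_recr//= -big_mkcond/=.
rewrite -/(prime_reciprocals R K); case: ifPn => _; last by rewrite mul1r addr0.
by rewrite mulrDr expRD mulrC ler_wpM2r ?expR_ge0.
Qed.

Lemma prime_reciprocals_unbounded (R : realType) (B : R) :
  exists N, B <= prime_reciprocals R N.
Proof.
apply/not_existsP => hB.
have : cvgn (series (@harmonic R)).
  apply: nondecreasing_is_cvgn.
    by apply: nondecreasing_series => n _ _; exact: harmonic_ge0.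
  exists (expR (2 * B)) => _ [N _ <-]; rewrite /series/=.
  have -> : \sum_(0 <= k < N) harmonic k = \sum_(1 <= n < N.+1) n%:R^-1 :> R.
    by rewrite big_add1.
  rewrite (le_trans (harmonic_le_expR _ _))// ler_expR ler_pM2l//.
  by have /negP := hB N; rewrite -ltNge => /ltW.
exact: dvg_harmonic.
Qed.

Lemma prime_reciprocals_step (R : realType) N :
  prime_reciprocals R N.+1 <= prime_reciprocals R N + 1.
Proof.
rewrite /prime_reciprocals big_mkcond big_nat_recr//= -big_mkcond/= lerD2l.
by case: ifP => // _; rewrite invf_le1// ler1n.
Qed.

Lemma prime_reciprocals_ge0 (R : realType) N : 0 <= prime_reciprocals R N.
Proof. by apply: sumr_ge0 => p _; rewrite invr_ge0. Qed.

Lemma prime_reciprocals_le (R : realType) N : prime_reciprocals R N <= N%:R.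
Proof.
elim: N => [|N IH]; first by rewrite /prime_reciprocals big_geq.
by rewrite (le_trans (prime_reciprocals_step _ _))// -natr1 lerD2r.
Qed.

(** The least N with h(N) >= B does not overshoot, the increments of h being at
    most 1. *)
Lemma prime_reciprocals_cross (R : realType) (B : R) : 0 < B ->
  exists N, B <= prime_reciprocals R N < B + 1.
Proof.
move=> B0; have exN := prime_reciprocals_unbounded B.
case: (ex_minnP exN) => -[|N] hN minN.
  by move: hN; rewrite /prime_reciprocals big_geq// leNgt B0.
exists N.+1; rewrite hN/= (le_lt_trans (prime_reciprocals_step _ _))// ltrD2r.
by rewrite ltNge; apply/negP => /minN; rewrite ltnn.
Qed.

(** * The normal order of Omega *)

Definition prime_omega (n : nat) : nat := size (primes n).

(** Summing over all primes up to [N] rather than over [primes n] lets sums over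
    [n] and over the primes be exchanged. *)
Lemma sum_primes_dvd (F : nat -> nat) n N : (0 < n <= N)%N ->
  (\sum_(p <- primes n) F p = \sum_(1 <= p < N.+1 | prime p) (p %| n) * F p)%N.
Proof.
case/andP=> n0 nN.
under [RHS]eq_bigr do rewrite mulnbl.
rewrite -big_mkcondr/= -[RHS]big_filter; apply: perm_big; apply: uniq_perm.
- exact: primes_uniq.
- by rewrite filter_uniq// iota_uniq.
- move=> p; rewrite mem_primes mem_filter mem_index_iota n0/=.
  case: (boolP (prime p)) => //= pp; case: (boolP (p %| n)%N) => //= pn.
  by rewrite prime_gt0//= ltnS (leq_trans _ nN)// dvdn_leq.
Qed.

Lemma prime_omegaE (R : realType) n N : (0 < n <= N)%N ->
  (prime_omega n)%:R = \sum_(1 <= p < N.+1 | prime p) (p %| n)%:R :> R.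
Proof.
move=> nN; rewrite /prime_omega -sum1_size (sum_primes_dvd _ nN) natr_sum.
by apply: eq_bigr => p _; rewrite muln1.
Qed.

Lemma count_multiples (R : realType) d N :
  \sum_(1 <= n < N.+1) (d %| n)%:R = (N %/ d)%:R :> R.
Proof. by rewrite divn_count_dvd natr_sum. Qed.

Lemma natr_divn_le (R : realType) d N : (0 < d)%N ->
  (N %/ d)%:R <= N%:R * d%:R^-1 :> R.
Proof.
by move=> d0; rewrite ler_pdivlMr ?ltr0n// -natrM ler_nat leq_divM.
Qed.

Lemma natr_divn_ge (R : realType) d N : (0 < d)%N ->
  N%:R * d%:R^-1 - 1 <= (N %/ d)%:R :> R.
Proof.
move=> d0; rewrite lerBlDr ler_pdivrMr ?ltr0n// natr1 -natrM ler_nat.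
by rewrite ltnW// ltn_ceil.
Qed.

Lemma omega_first_moment (R : realType) N :
  N%:R * prime_reciprocals R N - N%:R <=
  \sum_(1 <= n < N.+1) (prime_omega n)%:R.
Proof.
rewrite [leRHS]big_nat (eq_bigr (fun n => \sum_(1 <= p < N.+1 | prime p)
  (p %| n)%:R)) => [|n nN]; last exact: prime_omegaE.
rewrite -big_nat exchange_big/= /prime_reciprocals mulr_sumr.
have NE : N%:R = \sum_(1 <= p < N.+1) 1 :> R.
  by rewrite sumr_const_nat subn1.
apply: (@le_trans _ _ (\sum_(1 <= p < N.+1 | prime p) (N%:R * p%:R^-1 - 1))).
  rewrite sumrB lerD2l lerN2 NE [leLHS]big_mkcond/= ler_sum// => p _.
  by case: ifP.
by apply: ler_sum => p pp; rewrite count_multiples natr_divn_ge// prime_gt0.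
Qed.

(** The off-diagonal terms count the multiples of p q, at most N/(p q) of them;
    the diagonal contributes at most N/p for each p. *)
Lemma omega_second_moment (R : realType) N (h := prime_reciprocals R N) :
  \sum_(1 <= n < N.+1) (prime_omega n)%:R ^+ 2 <= N%:R * h ^+ 2 + N%:R * h.
Proof.
rewrite [leLHS]big_nat (eq_bigr (fun n => \sum_(1 <= p < N.+1 | prime p)
  \sum_(1 <= q < N.+1 | prime q) (p %| n)%:R * (q %| n)%:R)) => [|n nN]; last first.
  rewrite (prime_omegaE _ nN) expr2 mulr_suml.
  by apply: eq_bigr => p _; rewrite mulr_sumr.
rewrite -big_nat exchange_big/= {2}/h /prime_reciprocals.
have -> : N%:R * h ^+ 2 = \sum_(1 <= p < N.+1 | prime p)
    \sum_(1 <= q < N.+1 | prime q) N%:R * (p%:R^-1 * q%:R^-1).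
  rewrite expr2 mulr_suml mulr_sumr; apply: eq_bigr => p _.
  by rewrite mulrA mulr_sumr; apply: eq_bigr => q _; rewrite mulrA.
rewrite mulr_sumr -big_split/= big_nat_cond [leRHS]big_nat_cond ler_sum//.
move=> p /andP[pN pp]; rewrite exchange_big/=.
have pr : p \in [seq q <- index_iota 1 N.+1 | prime q].
  by rewrite mem_filter pp mem_index_iota.
have ur : uniq [seq q <- index_iota 1 N.+1 | prime q].
  by rewrite filter_uniq// iota_uniq.
rewrite -big_filter (bigD1_seq p pr ur)/= big_filter_cond.
rewrite -[in leRHS]big_filter [in leRHS](bigD1_seq p pr ur)/= big_filter_cond.
rewrite addrAC addrC [leRHS]addrC lerD//.
  apply: ler_sum => q /andP[qq pq].
  rewrite (eq_bigr (fun n => (p * q %| n)%:R)); last first.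
    have pq1 : coprime p q by rewrite prime_coprime// dvdn_prime2// eq_sym.
    move=> n _; rewrite Gauss_dvd//.
    by case: (p %| n)%N; case: (q %| n)%N; rewrite ?mulr0 ?mul0r ?mulr1.
  by rewrite count_multiples -invfM -natrM natr_divn_le// muln_gt0 !prime_gt0.
rewrite (eq_bigr (fun n => (p %| n)%:R)); last first.
  by move=> n _; case: (p %| n)%N; rewrite ?mulr0 ?mulr1.
rewrite count_multiples (le_trans (natr_divn_le _ _ _))// ?prime_gt0//.
by rewrite lerDr !mulr_ge0// invr_ge0.
Qed.

(** Turan's inequality. In the expanded square the terms N h ^ 2 cancel, and
    both moments leave an error of order N h. *)
Lemma turan (R : realType) N (h := prime_reciprocals R N) :
  \sum_(1 <= n < N.+1) ((prime_omega n)%:R - h) ^+ 2 <= 3 * N%:R * h.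
Proof.
have := omega_first_moment R N; have := omega_second_moment R N.
rewrite -/h; set S2 := (X in X <= _ -> _); set S1 := (X in _ -> _ <= X -> _).
move=> hS2 hS1; have h0 : 0 <= h := prime_reciprocals_ge0 R N.
have -> : \sum_(1 <= n < N.+1) ((prime_omega n)%:R - h) ^+ 2 =
    S2 - 2 * h * S1 + N%:R * h ^+ 2.
  have -> : N%:R * h ^+ 2 = \sum_(1 <= n < N.+1) h ^+ 2.
    by rewrite sumr_const_nat subn1 mulr_natl.
  rewrite mulr_sumr -sumrB -big_split/=; apply: eq_bigr => n _; ring.
nra.
Qed.

(** By Legendre's formula the exponents of p in 1, ..., N add up to the sum of
    N %/ p ^ k over k >= 1. The terms with k >= 2 form a geometric sum, at most
    N / (p (p - 1)), written here as a difference so that it telescopes over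
    p. *)
Lemma Omega_omega_p_excess (R : realType) p N : prime p ->
  \sum_(1 <= n < N.+1) (logn p n)%:R <=
  (N %/ p)%:R + N%:R * (p.-1%:R^-1 - p%:R^-1) :> R.
Proof.
move=> pp; have p1 := prime_gt1 pp.
have -> : \sum_(1 <= n < N.+1) (logn p n)%:R = (logn p N`!)%:R :> R.
  elim: N => [|N IH]; first by rewrite big_geq// logn1.
  by rewrite big_nat_recr//= IH factS lognM ?fact_gt0// addnC natrD.
rewrite logn_fact// natr_sum; case: N => [|N].
  by rewrite big_geq// div0n mul0r addr0.
rewrite big_nat_recl//= expn1 lerD2l.
have ip : 0 <= p%:R^-1 :> R by rewrite invr_ge0.
have p1R : 1 < p%:R :> R by rewrite ltr1n.
have p1E : p.-1%:R = p%:R - 1 :> R by rewrite -subn1 natrB// ltnW.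
(* the subtracted term is the tail of the geometric series after n terms *)
suff H n : \sum_(1 <= k < n.+1) (N.+1 %/ p ^ k.+1)%:R <=
    N.+1%:R * (p.-1%:R^-1 - p%:R^-1 - p.-1%:R^-1 * p%:R^-1 ^+ n.+1) :> R.
  rewrite (le_trans (H _))// ler_wpM2l// lerBlDr lerDl.
  by rewrite mulr_ge0 ?exprn_ge0// invr_ge0.
elim: n => [|n IH].
  rewrite big_geq// p1E mulr_ge0// expr1 le_eqVlt; apply/orP; left.
  by apply/eqP; field; lra.
rewrite big_nat_recr//=.
have pn0 : (0 < p ^ n.+2)%N by rewrite expn_gt0 (ltnW p1).
have := natr_divn_le R N.+1 pn0.
move=> /(lerD IH) /le_trans; apply; rewrite -mulrDr ler_wpM2l// natrX -exprVn.
rewrite p1E le_eqVlt; apply/orP; left; apply/eqP.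
rewrite (exprS _ n.+1); set z := _ ^+ n.+1; field; lra.
Qed.

Lemma Omega_omega_excess (R : realType) N :
  \sum_(1 <= n < N.+1) ((prime_Omega n)%:R - (prime_omega n)%:R) <= N%:R :> R.
Proof.
have -> : \sum_(1 <= n < N.+1) ((prime_Omega n)%:R - (prime_omega n)%:R) =
    \sum_(1 <= p < N.+1 | prime p)
       (\sum_(1 <= n < N.+1) (logn p n)%:R - (N %/ p)%:R) :> R.
  rewrite sumrB [RHS](eq_bigr (fun p => \sum_(1 <= n < N.+1) (logn p n)%:R -
    \sum_(1 <= n < N.+1) (p %| n)%:R)) => [|p _]; last first.
    by rewrite count_multiples.
  rewrite sumrB; congr (_ - _); rewrite exchange_big/= big_nat [RHS]big_nat;
      apply: eq_bigr => n nN; last exact: prime_omegaE.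
  rewrite /prime_Omega (sum_primes_dvd _ nN) natr_sum; apply: eq_bigr => p pp.
  case: (boolP (p %| n)%N) => [_|pn]; first by rewrite mul1n.
  by rewrite mul0n lognE (negbTE pn) !andbF.
apply: (@le_trans _ _ (N%:R *
    \sum_(1 <= p < N.+1 | prime p) (p.-1%:R^-1 - p%:R^-1))).
  rewrite mulr_sumr ler_sum// => p pp.
  by rewrite lerBlDl Omega_omega_p_excess.
rewrite -[leRHS]mulr1 ler_wpM2l//; case: N => [|N]; first by rewrite big_geq.
rewrite big_mkcond big_nat_recl//= add0r.
apply: (@le_trans _ _ (\sum_(1 <= p < N.+1) (- p.+1%:R^-1 - - p%:R^-1))).
  rewrite [leLHS]big_nat [leRHS]big_nat ler_sum// => p /andP[p0 _].
  rewrite opprK [leRHS]addrC; case: ifP => // _; rewrite subr_ge0.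
  by rewrite lef_pV2 ?posrE ?ltr0n// ler_nat.
by rewrite telescope_sumr// invr1 opprK addrC gerBl invr_ge0.
Qed.

Lemma prime_omega_le n : (prime_omega n <= prime_Omega n)%N.
Proof.
rewrite /prime_omega /prime_Omega -sum1_size big_seq [leqRHS]big_seq.
apply: leq_sum => p; rewrite mem_primes => /and3P[pp n0 pn].
by rewrite logn_gt0 mem_primes pp n0.
Qed.

(** Chebyshev's inequality: if Omega(n) is outside the interval then either
    omega(n) deviates from h by at least l, or Omega(n) exceeds omega(n) by at
    least l. The interval is longer on the right to leave room for the second
    alternative. *)
Lemma Omega_concentration (R : realType) N (l : R)
    (h := prime_reciprocals R N) : 0 < l ->
  \sum_(1 <= n < N.+1) (~~ (h - l < (prime_Omega n)%:R < h + 2 * l))%:R <=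
  N%:R * (3 * h / l ^+ 2 + l^-1).
Proof.
move=> l0.
apply: (@le_trans _ _ (\sum_(1 <= n < N.+1)
    ((l ^+ 2)^-1 * ((prime_omega n)%:R - h) ^+ 2 +
     l^-1 * ((prime_Omega n)%:R - (prime_omega n)%:R)))).
  apply: ler_sum => n _.
  have wW : (prime_omega n)%:R <= (prime_Omega n)%:R :> R.
    by rewrite ler_nat prime_omega_le.
  set w := (prime_omega n)%:R in wW *; set W := (prime_Omega n)%:R in wW *.
  have a0 : 0 <= (l ^+ 2)^-1 * (w - h) ^+ 2.
    by rewrite mulr_ge0 ?sqr_ge0// invr_ge0 sqr_ge0.
  have b0 : 0 <= l^-1 * (W - w) by rewrite mulr_ge0 ?subr_ge0// invr_ge0 ltW.
  case: (boolP (h - l < W < h + 2 * l)) => /= [_|]; first by rewrite addr_ge0.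
  rewrite negb_and -!leNgt => far.
  have [near|wfar] := ltP ((w - h) ^+ 2) (l ^+ 2); last first.
    rewrite -[leLHS]addr0 lerD// mulrC ler_pdivlMr ?mul1r//.
    by rewrite exprn_gt0.
  rewrite -[leLHS]add0r lerD// mulrC ler_pdivlMr// mul1r.
  by case/orP: far => far; nra.
rewrite big_split/= -!mulr_sumr mulrDr lerD//.
  rewrite mulrC [leRHS]mulrA ler_wpM2r ?invr_ge0 ?sqr_ge0//.
  by rewrite (le_trans (turan _ _))// mulrA (mulrC N%:R).
by rewrite mulrC ler_wpM2r ?invr_ge0 ?(ltW l0)// Omega_omega_excess.
Qed.

(** The window has length L = 4 l with l = c t, and M = t ^ 2. As h is of order
    t ^ 2 at these heights, Chebyshev's inequality leaves a proportion O(1/c) of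
    exceptions; c is chosen from [e], and then t so large that L / M = 4 c / t
    is small. *)
Lemma Omega_window (R : realType) (e eta : R) (k : nat) :
  0 < e -> 0 < eta ->
  exists M L, [/\ (0 < M)%N, L%:R <= eta * M%:R &
    forall m, (M <= m < 2 * M)%N -> exists2 N, (k < N)%N &
      \sum_(1 <= n < N.+1) (~~ (m <= prime_Omega n < m + L)%N)%:R <=
      e * N%:R].
Proof.
move=> e0 eta0.
(* 3 h / l ^ 2 + 1 / l <= 13 / c, because h <= 4 t ^ 2 and l = c t *)
pose c := (Num.truncn (13 / e)).+1.
pose t := maxn (maxn c k) (Num.truncn (4 * c%:R / eta)).+1.
have ct : (c <= t)%N by rewrite /t !leq_max leqnn.
have kt : (k <= t)%N by rewrite /t !leq_max leqnn !orbT.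
have c13 : 13 <= e * c%:R.
  by rewrite mulrC -ler_pdivrMr// ltW// truncnS_gt.
have et : 4 * c%:R <= eta * t%:R.
  rewrite mulrC [leRHS]mulrC -ler_pdivrMr// mulrC.
  by rewrite (le_trans (ltW (truncnS_gt _)))// ler_nat /t leq_max leqnn orbT.
have c1 : 1 <= c%:R :> R by rewrite ler1n.
have ctR : c%:R <= t%:R :> R by rewrite ler_nat.
pose l := (c * t)%N; have lE : l%:R = c%:R * t%:R :> R by rewrite natrM.
have t1 : 1 <= t%:R :> R by lra.
exists (t ^ 2)%N, (4 * l)%N; split; first by rewrite expn_gt0 -(ltr_nat R); lra.
  by rewrite natrM lE natrX; nra.
move=> m /andP[tm mt].
have l1 : 1 <= l%:R :> R by rewrite lE; nra.
have tmR : t%:R ^+ 2 <= m%:R :> R by rewrite -natrX ler_nat.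
have mtR : m%:R <= 2 * t%:R ^+ 2 :> R by rewrite -natrX -natrM ler_nat ltnW.
have [|N /andP[hge hlt]] := @prime_reciprocals_cross R (m%:R + l%:R).
  by nra.
exists N.
  rewrite -(ltr_nat R); have := prime_reciprocals_le R N.
  have : k%:R <= t%:R :> R by rewrite ler_nat.
  by nra.
set h := prime_reciprocals R N in hge hlt.
apply: (@le_trans _ _ (\sum_(1 <= n < N.+1)
    (~~ (h - l%:R < (prime_Omega n)%:R < h + 2 * l%:R))%:R)).
  apply: ler_sum => n _; rewrite ler_nat.
  case: (boolP (h - _ < _ < _)) => [/andP[Wge Wlt]|_]; last exact: leq_b1.
  suff -> : (m <= prime_Omega n < m + 4 * l)%N by [].
  apply/andP; split; first by rewrite -(ler_nat R); lra.
  by rewrite -(ltr_nat R) natrD natrM; lra.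
apply: (le_trans (Omega_concentration N (lt_le_trans ltr01 l1))).
rewrite -/h mulrC ler_wpM2r//.
have h4 : h <= 4 * t%:R ^+ 2 by rewrite lE in l1 hlt *; nra.
have -> : 3 * h / l%:R ^+ 2 + l%:R^-1 = (3 * h + l%:R) / l%:R ^+ 2.
  by field; lra.
rewrite ler_pdivrMr ?exprn_gt0 ?(lt_le_trans ltr01)//.
apply: (@le_trans _ _ (12 * t%:R ^+ 2 + c%:R * t%:R)); first by rewrite lE; lra.
apply: (@le_trans _ _ (13 * (c%:R * t%:R ^+ 2))).
  have : t%:R <= t%:R ^+ 2 :> R by rewrite expr2; nra.
  have : 1 * t%:R ^+ 2 <= c%:R * t%:R ^+ 2 :> R by rewrite ler_wpM2r ?sqr_ge0.
  by move=> H1 H2; have := ler_wpM2l (le_trans ler01 c1) H2; lra.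
have -> : e * l%:R ^+ 2 = e * c%:R * (c%:R * t%:R ^+ 2) by rewrite lE; ring.
by rewrite ler_wpM2r// mulr_ge0 ?sqr_ge0.
Qed.

(** * Sets swept by almost every orbit *)

Section MeasurePreservingIteration.
Context d (X : measurableType d) (R : realType) (mu : probability X R).
Context (T : X -> X) (mpT : measure_preserving mu T).

Lemma measurable_iter n : measurable_fun setT (iter n T).
Proof.
by elim: n => [|n IH]; [exact: measurable_id|exact: measurableT_comp mpT.1 IH].
Qed.

Lemma measurable_iter_preimage n (A : set X) :
  measurable A -> measurable (iter n T @^-1` A).
Proof. by move=> mA; rewrite -[X in measurable X]setTI; exact: measurable_iter. Qed.

Lemma mu_iter_preimage n (A : set X) :
  measurable A -> mu (iter n T @^-1` A) = mu A.
Proof.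
move=> mA; elim: n => [//|n IH].
rewrite -[RHS]IH -[RHS](mpT.2 _ (measurable_iter_preimage n mA)).
by congr (mu _); apply/seteqP; split => x /=; rewrite -iterSr.
Qed.

(** The union U satisfies T^-1 U <= U, so the intersection V of the sets T^-n U
    is exactly invariant; it has the measure of U because T preserves mu. *)
Lemma ergodic_sweep (A : set X) : ergodic mu T -> measurable A ->
  (0 < mu A)%E -> mu (\bigcup_n (iter n T @^-1` A)) = 1%E.
Proof.
move=> ergT mA A0; set U := \bigcup_n _.
have mU : measurable U.
  by apply: bigcup_measurable => n _; exact: measurable_iter_preimage.
pose V := \bigcap_n (iter n T @^-1` U).
have mV : measurable V.
  by apply: bigcapT_measurable => n; exact: measurable_iter_preimage.
have TU x n : U (iter n.+1 T x) -> U (iter n T x).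
  by move=> [m _ /= H]; exists m.+1 => //=; rewrite -iterS iterSr.
have TV : T @^-1` V = V.
  apply/seteqP; split => x Vx n _ /=; last by rewrite -iterSr; exact: Vx.
  by apply: TU; rewrite iterSr; exact: Vx.
have VU : mu V = mu U.
  have : (mu \o (fun n => iter n T @^-1` U)) n @[n --> \oo] --> mu V.
    apply: nonincreasing_cvg_mu => //.
    - by rewrite (le_lt_trans (probability_le1 _ _))// ?ltry//.
    - by move=> n; exact: measurable_iter_preimage.
    - move=> m n /subnKC <-; apply/subsetPset.
      elim: (n - m)%N => [|l IH]; first by rewrite addn0.
      by rewrite addnS; apply: subset_trans IH => x; exact: TU.
  have -> : mu \o (fun n => iter n T @^-1` U) = cst (mu U).
    by apply/funext => n /=; rewrite mu_iter_preimage.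
  by move=> /cvg_lim <-//; rewrite lim_cst.
have U0 : (0 < mu U)%E.
  rewrite (lt_le_trans A0)// le_measure ?inE// => x Ax; by exists 0%N.
by have [V0|V1] := ergT _ mV TV; rewrite -VU// in U0 *; rewrite V0 ltxx in U0.
Qed.

Lemma non_atomic_halve (A : set X) : non_atomic mu -> measurable A ->
  (0 < mu A)%E ->
  exists B, [/\ measurable B, (0 < mu B)%E & (mu B + mu B <= mu A)%E].
Proof.
move=> na mA A0; have [B [mB BA B0 BneA]] : exists B, [/\ measurable B,
    B `<=` A, mu B <> 0%E & mu B <> mu A].
  apply: contrapT => H; apply: na; exists A; split=> // B mB BA.
  by apply: contrapT => /not_orP[B0 B1]; apply: H; exists B.
have mD : measurable (A `\` B) by exact: measurableD.
have AE : mu A = (mu B + mu (A `\` B))%E.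
  by rewrite -measureU ?setDIK// setDUK.
have [BD|DB] := leP (mu B) (mu (A `\` B)).
  exists B; split=> //; last by rewrite AE leeD2l.
  by rewrite lt0e measure_ge0 andbT; exact/eqP.
exists (A `\` B); split=> //; last by rewrite AE leeD2r// ltW.
rewrite lt0e measure_ge0 andbT; apply/eqP => D0.
by apply: BneA; rewrite AE D0 adde0.
Qed.

(** Halving a set of measure at most 1/M, M >= 1, gives one of measure at most
    1/(2M) <= 1/(M + 1). *)
Lemma non_atomic_small M : non_atomic mu -> (0 < M)%N ->
  exists A, [/\ measurable A, (0 < mu A)%E & (mu A <= (M%:R^-1)%:E)%E].
Proof.
move=> na; elim: M => [//|[|M] IH] _.
  by exists setT; rewrite probability_setT invr1; split.
have [//|A [mA A0 AM]] := IH.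
have [B [mB B0 BA]] := non_atomic_halve na mA A0; exists B; split=> //.
have := le_trans BA AM; have fB := fin_num_measure mu B mB.
rewrite -(fineK fB) -EFinD !lee_fin; set b := fine _ => bM.
have M0 : 0 <= M%:R :> R by [].
have b0 : 0 <= b by exact: fine_ge0.
rewrite -[leRHS]mul1r ler_pdivlMr ?ltr0n//.
have := ler_wpM2r (ler0n R M.+1) bM; rewrite mulVf//.
by rewrite -!natr1; nra.
Qed.

Let first_visit (A : set X) j : set X :=
  [set x | A (iter j T x) /\ forall i, (i < j)%N -> ~ A (iter i T x)].

Let measurable_first_visit A j : measurable A -> measurable (first_visit A j).
Proof.
move=> mA; have -> : first_visit A j = (iter j T @^-1` A) `&`
    \bigcap_(i in `I_j) ~` (iter i T @^-1` A) by [].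
apply: measurableI; first exact: measurable_iter_preimage.
apply: bigcap_measurableType => i _; apply: measurableC.
exact: measurable_iter_preimage.
Qed.

Let first_visit_uniq A i j x : first_visit A i x -> first_visit A j x -> i = j.
Proof.
move=> [Ai Hi] [Aj Hj]; have [ij|ji|//] := ltngtP i j.
  by have := Hj _ ij Ai.
by have := Hi _ ji Aj.
Qed.

Let first_visit_shift A i j x : (i <= j)%N -> first_visit A j x ->
  first_visit A (j - i) (iter i T x).
Proof.
move=> ij [Aj Hj]; split; first by rewrite -iterD subnK.
by move=> l lj; rewrite -iterD; apply: Hj; lia.
Qed.

(** Let A be a small set of positive measure and F the set of points whose first
    visit to A occurs at a time that is a multiple of M. The time left before
    that visit decreases by 1 along the orbit, so an orbit that reaches A passes
    through F within M steps. Apart from A itself, F is the set F1 of points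
    with a positive multiple as first visit time; its images under the first M
    iterates lie in the disjoint sets D i of points whose first visit time is
    congruent to - i modulo M, whence M mu F1 <= 1. *)
Lemma sweeping_base M : ergodic mu T -> non_atomic mu -> (0 < M)%N ->
  exists F, [/\ measurable F, (mu F <= (2 / M%:R)%:E)%E &
    mu (\bigcup_(i in `I_M) (iter i T @^-1` F)) = 1%E].
Proof.
move=> ergT naX M0; have [A [mA A0 AM]] := non_atomic_small naX M0.
have mfv j := measurable_first_visit j mA.
pose F1 := \bigcup_k first_visit A (k.+1 * M).
have mF1 : measurable F1 by exact: bigcup_measurable.
exists (A `|` F1); split; first exact: measurableU.
  rewrite (le_trans (measureU2 _ _ _))//.
  suff F1M : (mu F1 <= (M%:R^-1)%:E)%E.
    by rewrite (le_trans (leeD AM F1M))// -EFinD lee_fin; lra.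
  pose D (i : 'I_M) := \bigcup_k first_visit A (k.+1 * M - i).
  have mD i : measurable (D i) by exact: bigcup_measurable.
  have iM k (i : 'I_M) : (i <= k.+1 * M)%N by have := ltn_ord i; lia.
  have tD : trivIset setT D.
    move=> i j _ _ [x [[k _ xi] [l _ xj]]]; apply/val_inj => /=.
    have := first_visit_uniq xi xj.
    have := ltn_ord i; have := ltn_ord j; have [kl|lk|->] := ltngtP k l; last by lia.
      have : (k.+2 * M <= l.+1 * M)%N by rewrite leq_mul2r ltnS kl orbT.
      by rewrite (mulSn k.+1); lia.
    have : (l.+2 * M <= k.+1 * M)%N by rewrite leq_mul2r ltnS lk orbT.
    by rewrite (mulSn l.+1); lia.
  have F1D i : (mu F1 <= mu (D i))%E.
    rewrite -(mu_iter_preimage i (mD i)) le_measure ?inE//.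
      exact: measurable_iter_preimage.
    by move=> x [k _ xk]; exists k => //; exact: first_visit_shift.
  have := probability_le1 mu (bigsetU_measurable (index_enum 'I_M) (P := xpredT)
    (fun i _ => mD i)).
  rewrite measure_bigsetU_ord// => /(le_trans (lee_sum _ (fun i _ => F1D i))).
  have fF1 := fin_num_measure mu F1 mF1; rewrite -(fineK fF1) sumEFin !lee_fin.
  rewrite sumr_const card_ord => F1M.
  by rewrite -div1r ler_pdivlMr ?ltr0n// mulr_natr.
have mF : measurable (A `|` F1) by exact: measurableU.
apply/eqP; rewrite eq_le probability_le1 ?andTb; last first.
  by apply: bigcup_measurable => i _; exact: measurable_iter_preimage.
rewrite -(ergodic_sweep ergT mA A0) le_measure ?inE//.
- by apply: bigcup_measurable => i _; exact: measurable_iter_preimage.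
- by apply: bigcup_measurable => i _; exact: measurable_iter_preimage.
move=> x [j0 _ Aj0].
have exj : exists j, `[< A (iter j T x) >] by exists j0; apply/asboolP.
case: (ex_minnP exj) => j /asboolP Aj minj.
have fj : first_visit A j x.
  split=> // i ij /asboolP Ai; have := minj _ Ai; lia.
exists (j %% M)%N => /=; first by rewrite ltn_mod.
have := first_visit_shift (leq_mod j M) fj.
rewrite {1}(divn_eq j M) addnK; case: (j %/ M)%N => [|k] H; [left|right].
  by case: H.
by exists k.
Qed.

End MeasurePreservingIteration.

(** * Averages along Omega *)

Section OmegaAverages.
Context (R : realType) (X : Type) (T : X -> X).
Implicit Types A B E : set X.

Lemma Omega_average_ge0 A x N : 0 <= Omega_average R T A x N.
Proof.
by rewrite mulr_ge0 ?invr_ge0// sumr_ge0// => n _; rewrite indicE.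
Qed.

Lemma Omega_averageC A x N : (0 < N)%N ->
  Omega_average R T (~` A) x N = 1 - Omega_average R T A x N.
Proof.
move=> N0; apply/eqP; rewrite -subr_eq opprK -mulrDr -big_split/=.
rewrite (eq_bigr (fun=> 1)) => [|n _]; last first.
  by rewrite !indicE in_setC; case: (_ \in A); rewrite ?addr0 ?add0r.
by rewrite sumr_const_nat subn1 mulVf// pnatr_eq0 -lt0n.
Qed.

Lemma Omega_average_le1 A x N : Omega_average R T A x N <= 1.
Proof.
have [->|N0] := posnP N.
  by rewrite /Omega_average big_geq// mulr0.
by rewrite -subr_ge0 -Omega_averageC// Omega_average_ge0.
Qed.

Lemma le_Omega_average A B x N :
  (forall n, (n <= N)%N ->
    A (iter (prime_Omega n) T x) -> B (iter (prime_Omega n) T x)) ->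
  Omega_average R T A x N <= Omega_average R T B x N.
Proof.
move=> AB; rewrite ler_wpM2l ?invr_ge0// big_nat [leRHS]big_nat ler_sum//.
move=> n /andP[_ nN]; rewrite !indicE ler_nat.
by have [/set_mem/(AB _ nN)/mem_set->|//] := boolP (_ \in A).
Qed.

(** The upper bound [K] makes this a condition on finitely many iterates of [T],
    hence stable under small changes of [A]. *)
Definition reaches (e : R) (k K : nat) A : set X :=
  [set x | exists2 N, (k < N <= K)%N & 1 - e < Omega_average R T A x N].

Lemma reachesE e k K A : reaches e k K A =
  \bigcup_(N in [set N | (k < N <= K)%N])
    [set x | 1 - e < Omega_average R T A x N].
Proof. by apply/seteqP; split => x [N]; exists N. Qed.

Lemma sub_reaches e k K A B : A `<=` B -> reaches e k K A `<=` reaches e k K B.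
Proof.
move=> AB x [N kN AN]; exists N => //; apply: (lt_le_trans AN).
by apply: le_Omega_average => n _; exact: AB.
Qed.

(** Off the last union, the orbit of x meets A and B at the same times
    Omega(n), n <= K. *)
Lemma reaches_perturb e k K A B : reaches e k K A `<=`
  reaches e k K B `|`
  \bigcup_(n in `I_K.+1) (iter (prime_Omega n) T @^-1` (A `+` B)).
Proof.
move=> x [N kN AN]; apply: contrapT => /not_orP[xB xAB]; apply: xB.
exists N => //; apply: (lt_le_trans AN); apply: le_Omega_average => n nN An.
apply: contrapT => Bn; apply: xAB; exists n => /=; last by left; split.
by case/andP: kN => _ NK; rewrite ltnS (leq_trans nN).
Qed.

Lemma reaches_trap e k N K E x m L : (k < N <= K)%N -> 0 < e ->
  (forall j, (m <= j < m + L)%N -> E (iter j T x)) ->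
  \sum_(1 <= n < N.+1) (~~ (m <= prime_Omega n < m + L)%N)%:R <=
    (e / 2) * N%:R ->
  reaches e k K E x.
Proof.
move=> kNK e0 Ej few; exists N => //.
have N0 : (0 < N)%N by case/andP: kNK => kN _; exact: leq_trans kN.
have N0R : 0 < N%:R :> R by rewrite ltr0n.
apply: (@lt_le_trans _ _ (1 - e / 2)); first by lra.
rewrite lerBlDl -lerBlDr -Omega_averageC// /Omega_average.
rewrite mulrC ler_pdivrMr//; apply: le_trans few; apply: ler_sum => n _.
rewrite indicE ler_nat in_setC.
by have [/Ej/mem_set->|/=] := boolP (m <= prime_Omega n < m + L)%N; rewrite ?leq_b1.
Qed.

End OmegaAverages.

Section Visits.
Context d (X : measurableType d) (R : realType) (mu : probability X R).
Context (T : X -> X) (mpT : measure_preserving mu T).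

Lemma measurable_setY (A B : set X) :
  measurable A -> measurable B -> measurable (A `+` B).
Proof.
by move=> mA mB; rewrite setY_def; apply: measurableU; exact: measurableD.
Qed.

Lemma measurable_Omega_average (A : set X) N : measurable A ->
  measurable_fun setT (fun x => Omega_average R T A x N).
Proof.
move=> mA; apply: measurable_funM; first exact: measurable_cst.
apply: measurable_sum => n.
exact: (measurableT_comp (measurable_indic mA) (measurable_iter mpT _)).
Qed.

Lemma measurable_reaches (e : R) k K (A : set X) : measurable A ->
  measurable (reaches (R := R) T e k K A).
Proof.
move=> mA; rewrite reachesE; apply: bigcup_measurable => N _.
rewrite -[X in measurable X]setTI.
have := measurable_fun_ltr (measurable_cst (1 - e))
  (measurable_Omega_average N mA).
by move=> /(_ measurableT [set true] I).
Qed.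

Lemma mu_reaches_perturb (e : R) k K (A B : set X) : measurable A -> measurable B ->
  (mu (reaches T e k K A) <=
   mu (reaches T e k K B) + K.+1%:R%:E * mu (A `+` B))%E.
Proof.
move=> mA mB.
have mAB := measurable_setY mA mB.
pose D n := iter (prime_Omega n) T @^-1` (A `+` B).
have mD n : measurable (D n) by exact: (measurable_iter_preimage mpT).
pose U := \big[setU/set0]_(n < K.+1) D n.
have mU : measurable U by exact: bigsetU_measurable.
have mR C : measurable C -> measurable (reaches (R := R) T e k K C).
  exact: measurable_reaches.
apply: (@le_trans _ _ (mu (reaches T e k K B `|` U))).
  rewrite le_measure ?inE//; [exact: mR|by apply: measurableU => //; exact: mR|].
  by rewrite /U -bigcup_mkord; exact: reaches_perturb.
rewrite (le_trans (measureU2 _ (mR _ mB) mU))// leeD2l//.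
rewrite (le_trans (content_subadditive mu (F := D) (n := K.+1) _ _ _))//.
rewrite (eq_bigr (fun=> mu (A `+` B))) => [|n _]; last first.
  exact: (mu_iter_preimage mpT).
rewrite -(fineK (fin_num_measure mu _ mAB)) sumEFin -EFinM lee_fin.
by rewrite sumr_const card_ord mulr_natl.
Qed.

(** E consists of the points that enter F within the next L steps, so a visit to
    F at time m + L puts T^j x in E throughout the window [m, m + L). The sweep
    provides such a visit with m in [M, 2M), and [K] bounds the finitely many
    corresponding N. *)
Lemma Omega_trap (e delta : R) k : ergodic mu T -> non_atomic mu ->
  0 < e -> 0 < delta ->
  exists E K, [/\ measurable E, (mu E <= delta%:E)%E &
    mu (reaches T e k K E) = 1%E].
Proof.
move=> ergT naX e0 delta0.
have e20 : 0 < e / 2 by lra.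
have d20 : 0 < delta / 2 by lra.
have [M [L [M0 LM window]]] := Omega_window k e20 d20.
have [F [mF FM Fsweep]] := sweeping_base mpT ergT naX M0.
have /choice[f fP] : forall m, exists N, (M <= m < 2 * M)%N ->
    (k < N)%N /\ \sum_(1 <= n < N.+1)
      (~~ (m <= prime_Omega n < m + L)%N)%:R <= e / 2 * N%:R.
  move=> m; have [/window[N kN hN]|_] := boolP (M <= m < 2 * M)%N.
    by exists N.
  by exists 0%N.
pose K := (\max_(m < 2 * M) f m)%N.
pose G i := iter i.+1 T @^-1` F.
have mG i : measurable (G i) by exact: (measurable_iter_preimage mpT).
pose E := \big[setU/set0]_(i < L) G i.
have mE : measurable E by exact: bigsetU_measurable.
exists E, K; split=> //.
  rewrite (le_trans (content_subadditive mu (F := G) (n := L) _ _ _))//.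
  rewrite (eq_bigr (fun=> mu F)) => [|n _]; last exact: (mu_iter_preimage mpT).
  move: FM; rewrite -(fineK (fin_num_measure mu _ mF)) sumEFin !lee_fin.
  rewrite sumr_const card_ord -[fine _ *+ L]mulr_natr => FM.
  apply: (le_trans (ler_wpM2r (ler0n _ _) FM)).
  have M0R : 0 < M%:R :> R by rewrite ltr0n.
  by rewrite mulrAC ler_pdivrMr//; lra.
have mR : measurable (reaches T e k K E) by exact: measurable_reaches.
apply/eqP; rewrite eq_le probability_le1//= -Fsweep.
set S := \bigcup_(i in _) _.
have mS : measurable S.
  by apply: bigcup_measurable => i _; exact: (measurable_iter_preimage mpT).
rewrite -(mu_iter_preimage mpT (M + L) mS) le_measure ?inE//.
  exact: (measurable_iter_preimage mpT).
move=> x [i /= iM]; rewrite -iterD => Fx.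
have mM : (M <= M + i < 2 * M)%N by lia.
have [kN few] := fP _ mM.
have NK : (f (M + i) <= K)%N.
  have mM2 : (M + i < 2 * M)%N by case/andP: mM.
  exact: (leq_bigmax (Ordinal mM2)).
apply: (reaches_trap (N := f (M + i)) _ e0 _ few); first by rewrite kN.
move=> j /andP[mj jm]; rewrite /E -bigcup_mkord.
(* G l asks for a visit after l + 1 steps; here from time j to time M + i + L *)
exists (M + i + L - j).-1%N => /=; first by lia.
rewrite /G /=; rewrite -iterS -iterD.
by have -> : ((M + i + L - j).-1.+1 + j = i + (M + L))%N by lia.
Qed.

End Visits.

(** * Upper and lower limits of a sequence *)

Section FrequentBound.
Context (R : realType).
Implicit Types u : nat -> R.

Lemma invrS_lt (e : R) k : 0 < e -> exists2 j, (k <= j)%N & j.+1%:R^-1 < e.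
Proof.
move=> e0; exists (maxn k (Num.truncn e^-1)); first exact: leq_maxl.
rewrite -ltf_pV2 ?posrE ?invr_gt0// invrK (lt_le_trans (truncnS_gt _))//.
by rewrite ler_nat ltnS leq_maxr.
Qed.

Lemma sups_frequent u (l : R) : (forall n, u n <= l) ->
  (forall k, exists2 N, (k < N)%N & l - k.+1%:R^-1 < u N) -> sups u = cst l.
Proof.
move=> ul freq; apply/funext => n; rewrite /sups /=.
have ubl : ubound (sdrop u n) l by move=> _ [m _ <-]; exact: ul.
apply/eqP; rewrite eq_le; apply/andP; split.
  by apply: ge_sup => //; exists (u n), n => /=.
apply/ler_addgt0Pr => e /(@invrS_lt _ n)[k nk ke].
have [N kN /ltW uN] := freq k.
have : u N <= sup (sdrop u n).
  by apply: ub_le_sup; [exists l|exists N => //; exact: leq_trans nk (ltnW kN)].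
rewrite -lerBlDr; apply: le_trans; apply: le_trans uN.
by rewrite lerD2l lerN2 ltW.
Qed.

Lemma limn_sup_frequent u (l : R) : (forall n, u n <= l) ->
  (forall k, exists2 N, (k < N)%N & l - k.+1%:R^-1 < u N) -> limn_sup u = l.
Proof. by move=> ul freq; rewrite /limn_sup (sups_frequent ul freq) lim_cst. Qed.

Lemma limn_inf_frequent u (l : R) : (forall n, l <= u n) ->
  (forall k, exists2 N, (k < N)%N & u N < l + k.+1%:R^-1) -> limn_inf u = l.
Proof.
move=> ul freq; rewrite /limn_inf.
have := @sups_frequent (-%R \o u) (- l) _ _; rewrite supsN => H.
suff -> : infs u = cst l by rewrite lim_cst.
rewrite -[infs u]opprK H ?funeqE//=.
- by move=> n /=; rewrite /GRing.opp/= opprK.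
- by move=> n; rewrite lerN2.
- by move=> k; have [N kN uN] := freq k; exists N => //=; rewrite -opprD ltrN2.
Qed.

End FrequentBound.

(** * Completeness and Baire's theorem for measurable sets *)

Section Completeness.
Context d (X : measurableType d) (R : realType) (mu : probability X R).

(** The limit is the lower limit of the sets. A point where it differs from A n
    must enter or leave the sequence at some step j >= n, and the measures of
    these steps are dominated by a geometric series. *)
Lemma symdiff_limit (A : nat -> set X) (r : nat -> R) :
  (forall n, measurable (A n)) -> (forall n, 0 <= r n) ->
  (forall n, r n.+1 <= r n / 2) ->
  (forall n, (mu (A n `+` A n.+1) <= (r n / 2)%:E)%E) ->
  exists2 C, measurable C & forall n, (mu (A n `+` C) <= (r n)%:E)%E.
Proof.
move=> mA r0 rS Ar.
pose C := \bigcup_n \bigcap_(m in [set m | (n <= m)%N]) A m.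
have mC : measurable C.
  by apply: bigcup_measurable => n _; apply: bigcap_measurableType => m _.
exists C => // n.
have rD j : r (n + j)%N <= r n / (2 ^ j)%:R.
  elim: j => [|j IH]; first by rewrite addn0 expn0 divr1.
  rewrite addnS (le_trans (rS _))// expnSr natrM invfM mulrA.
  by rewrite ler_pM2r.
apply: (@le_trans _ _ (\sum_(0 <= j <oo) mu (A (n + j)%N `+` A (n + j).+1))%E).
  apply: measure_sigma_subadditive; [|exact: measurable_setY|].
    by move=> j; exact: measurable_setY.
  move=> x AnC; apply: contrapT => stays.
  have same j : A (n + j)%N x <-> A n x.
    elim: j => [|j IH]; first by rewrite addn0.
    rewrite addnS -IH; apply: contrapT => change; apply: stays.
    exists j => //; rewrite setY_def /=.
    by have [] := pselect (A (n + j)%N x); have [] := pselect (A (n + j).+1 x);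
      tauto.
  have CA : C x <-> A n x.
    split=> [[m _ Am]|An].
      by apply/(same m); apply: Am => /=; exact: leq_addl.
    by exists n => // m /= nm; rewrite -(subnKC nm); apply/same.
  by move: AnC; rewrite setY_def /=; tauto.
apply: le_trans (epsilon_trick0 xpredT (r0 n)).
apply: lee_nneseries => // j _; rewrite (le_trans (Ar _))// lee_fin.
by rewrite expnSr natrM invfM mulrA ler_pM2r.
Qed.

Local Notation M := (measurable_sets mu).

Lemma mset_val_surj (A : set X) : measurable A ->
  exists B : M, mset_val B = A.
Proof. by move=> mA; exists (SigSub (mem_set mA)). Qed.

Lemma open_ball_sub (F : set M) (A : M) : open F -> F A ->
  exists2 r : R, 0 < r & ball A r `<=` F.
Proof.
rewrite openE => oF /oF; rewrite /interior => /nbhs_ballP[r r0 rF].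
by exists r.
Qed.

Lemma dense_symdiff (F : set M) :
  (forall (A : M) (r : R), 0 < r -> exists2 B : M, F B & symdiff_dist A B < r) <->
  dense F.
Proof.
split=> [FA O [A OA] oO|dF A r r0].
  have [r r0 rO] := open_ball_sub oO OA; have [B FB AB] := FA A r r0.
  by exists B; split=> //; apply: rO; rewrite mset_ballE.
have [|B [AB FB]] := dF (interior (ball A r)) _ (open_interior _).
  by exists A; exact: nbhsx_ballx.
by exists B => //; have := interior_subset AB; rewrite mset_ballE.
Qed.

(** The usual nested balls: each closed ball is inside the next open set, its
    radius is at most half of the previous one, and its center is within half of
    the previous radius, which is what [symdiff_limit] requires for the limit to
    lie in all the balls. *)
Lemma measurable_sets_Baire (F : nat -> set M) :
  (forall n, open (F n)) -> (forall n, dense (F n)) -> dense (\bigcap_n F n).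
Proof.
move=> oF dF; apply/dense_symdiff => A0 r0 r00.
have /choice[f fP] : forall nAr : nat * (M * R), exists Bs : M * R,
    0 < nAr.2.2 -> [/\ symdiff_dist nAr.2.1 Bs.1 <= nAr.2.2 / 2,
      0 < Bs.2, Bs.2 <= nAr.2.2 / 2 &
      forall C, symdiff_dist Bs.1 C <= Bs.2 -> F nAr.1 C].
  move=> [n [A r]] /=; have [r1|r1] := ltP 0 r; last by exists (A, r).
  have r2 : 0 < r / 2 by lra.
  have /dense_symdiff/(_ A _ r2)[B FB AB] := dF n.
  have [s s0 sF] := open_ball_sub (oF n) FB.
  exists (B, Num.min (s / 2) (r / 2)) => /= _; split.
  - exact: ltW.
  - by rewrite lt_min; lra.
  - by rewrite ge_min lexx orbT.
  - move=> C BC; apply: sF; rewrite mset_ballE /=.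
    by rewrite (le_lt_trans BC)// gt_min; lra.
pose ar := fix ar n := if n is m.+1 then f (m, ar m) else (A0, r0 / 2).
have ar0 n : 0 < (ar n).2.
  elim: n => [|n IH] /=; first by lra.
  by have [] := fP (n, ar n) IH.
have [||||C mC AC] := @symdiff_limit (fun n => mset_val (ar n).1)
    (fun n => (ar n).2).
- by move=> n; exact: mset_valP.
- by move=> n; exact: ltW.
- by move=> n; have [] := fP (n, ar n) (ar0 n).
- by move=> n; rewrite -symdiff_distE lee_fin; have [] := fP (n, ar n) (ar0 n).
have [C' C'E] := mset_val_surj mC; exists C'; last first.
  rewrite -lte_fin symdiff_distE C'E (le_lt_trans (AC 0%N))// lte_fin /=; lra.
move=> n _; have [_ _ _] := fP (n, ar n) (ar0 n); apply.
by rewrite -lee_fin symdiff_distE C'E; exact: (AC n.+1).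
Qed.

End Completeness.

(** * The generic behaviour of the averages *)

Section OftenClose.
Context d (X : measurableType d) (R : realType) (mu : probability X R).
Context (T : X -> X) (mpT : measure_preserving mu T).
Local Notation M := (measurable_sets mu).

(** One index [k] governs the closeness of the average to 1, the measure of the
    exceptional set and the least admissible time; as [k] grows all three become
    stricter. *)
Definition often k (A : set X) : Prop :=
  exists K, ((1 - k.+1%:R^-1)%:E < mu (reaches (R := R) T k.+1%:R^-1 k K A))%E.

Lemma often_stable k (A : set X) : measurable A -> often k A ->
  exists2 r : R, 0 < r &
    forall B, measurable B -> (mu (A `+` B) < r%:E)%E -> often k B.
Proof.
move=> mA [K AK]; set e : R := k.+1%:R^-1 in AK *.
have mr B : measurable B -> measurable (reaches (R := R) T e k K B).
  exact: (measurable_reaches mpT).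
move: AK; rewrite -(fineK (fin_num_measure mu _ (mr _ mA))) lte_fin.
set a := fine _ => AK.
have K0 : 0 < K.+1%:R :> R by rewrite ltr0n.
exists ((a - (1 - e)) / K.+1%:R) => [|B mB]; first by rewrite divr_gt0; lra.
have mAB := measurable_setY mA mB.
move=> ABr; exists K; move: ABr (mu_reaches_perturb mpT e k K mA mB).
rewrite -(fineK (fin_num_measure mu _ (mr _ mA))).
rewrite -(fineK (fin_num_measure mu _ (mr _ mB))).
rewrite -(fineK (fin_num_measure mu _ mAB)) -EFinM -EFinD lee_fin !lte_fin.
by rewrite -/a ltr_pdivlMr// mulrC -/e; lra.
Qed.

Lemma often_trap k (delta : R) : ergodic mu T -> non_atomic mu -> 0 < delta ->
  exists E, [/\ measurable E, (mu E <= delta%:E)%E &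
    forall B, measurable B -> E `<=` B -> often k B].
Proof.
move=> ergT naX delta0; have e0 : 0 < k.+1%:R^-1 :> R by rewrite invr_gt0.
have [E [K [mE Ed E1]]] := Omega_trap mpT k ergT naX e0 delta0.
exists E; split=> // B mB EB; exists K.
have : (mu (reaches (R := R) T k.+1%:R^-1 k K E) <=
    mu (reaches (R := R) T k.+1%:R^-1 k K B))%E.
  by rewrite le_measure ?inE//; [exact: (measurable_reaches mpT)..|exact: sub_reaches].
by apply: lt_le_trans; rewrite E1 lte_fin ltrBlDr ltrDl.
Qed.

(** For j >= k the condition of index j also gives an average at a time after k
    that exceeds 1 - 1/(k + 1), on a set of measure more than 1 - 1/(j + 1);
    letting j grow, almost every point has one. *)
Lemma often_ae (A : set X) : measurable A -> (forall k, often k A) ->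
  {ae mu, forall x, forall k, exists2 N, (k < N)%N &
    1 - k.+1%:R^-1 < Omega_average R T A x N}.
Proof.
move=> mA oA; apply: ae_foralln => k.
pose G := \bigcup_K reaches (R := R) T k.+1%:R^-1 k K A.
have mG : measurable G.
  by apply: bigcup_measurable => K _; exact: (measurable_reaches mpT).
exists (~` G); split; first exact: measurableC.
  apply: (eq_trans (probability_setC mu mG)).
  suff -> : mu G = 1%E by rewrite subee.
  apply/eqP; rewrite eq_le probability_le1//=.
  rewrite -(fineK (fin_num_measure mu _ mG)) lee_fin.
  apply/ler_addgt0Pr => e /(@invrS_lt _ _ k)[j kj je].
  have [K jK] := oA j.
  have : 1 - j.+1%:R^-1 < fine (mu G).
    rewrite -lte_fin fineK ?fin_num_measure// (lt_le_trans jK)// le_measure ?inE//.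
      exact: (measurable_reaches mpT).
    move=> x [N /andP[jN NK] AN]; exists K => //; exists N; first by lia.
    rewrite (le_lt_trans _ AN)// lerD2l lerN2 lef_pV2 ?posrE ?ltr0n//.
    by rewrite ler_nat.
  by rewrite -lerBlDr => /ltW; apply: le_trans; rewrite lerD2l lerN2 ltW.
move=> x /= nx [K _ [N /andP[kN _] AN]]; apply: nx; exists N => //.
Qed.

(** Complementing a set exchanges averages close to 1 and close to 0, and it is
    an isometry for the symmetric difference. *)
Definition side (b : bool) (A : set X) : set X := if b then A else ~` A.

Lemma measurable_side b A : measurable A -> measurable (side b A).
Proof. by case: b => //= mA; exact: measurableC. Qed.

Lemma side_setY b A B : side b A `+` side b B = A `+` B.
Proof.
case: b => //=; rewrite !setY_def; apply/seteqP.
by split=> x /=; have [] := pselect (A x); have [] := pselect (B x); tauto.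
Qed.

Definition often_sets b k : set M := [set A | often k (side b (mset_val A))].

Lemma open_often_sets b k : open (often_sets b k).
Proof.
rewrite openE => A oA; have mA := measurable_side b (mset_valP A).
have [r r0 rA] := often_stable mA oA.
apply/nbhs_ballP; exists r => //= B; rewrite mset_ballE /= => AB.
apply: rA; first exact/measurable_side/mset_valP.
by rewrite side_setY -symdiff_distE lte_fin.
Qed.

Lemma dense_often_sets b k : ergodic mu T -> non_atomic mu ->
  dense (often_sets b k).
Proof.
move=> ergT naX; apply/dense_symdiff => A r r0.
have r2 : 0 < r / 2 by lra.
have [E [mE Er Eoften]] := often_trap k ergT naX r2.
have mA := mset_valP A.
pose B := if b then mset_val A `|` E else mset_val A `\` E.
have mB : measurable B.
  by rewrite /B; case: ifP => _; [exact: measurableU|exact: measurableD].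
have [B' B'E] := mset_val_surj mu mB; exists B'.
  rewrite /often_sets /= B'E; apply: Eoften; first exact: measurable_side.
  by move=> x Ex; rewrite /B /side; case: (b) => /=; [right|case].
rewrite -lte_fin symdiff_distE B'E.
apply: (@le_lt_trans _ _ (mu E)); last by rewrite (le_lt_trans Er)// lte_fin; lra.
rewrite le_measure ?inE//; first exact: measurable_setY.
by rewrite setY_def /B => x; case: ifP => _ /=; have [] := pselect (E x); tauto.
Qed.

End OftenClose.

Theorem mainTheorem2 (R : realType) (X : pmetricType R)
    (compactX : compact [set: X]) (mu : probability (borel X) R)
    (T : borel X -> borel X) (mpT : measure_preserving mu T)
    (ergT : ergodic mu T) (naX : non_atomic mu) :
  exists calR : set (measurable_sets mu),
    [/\ Gdelta calR, dense calR &
        forall A : measurable_sets mu, calR A ->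
          {ae mu, forall x : borel X,
            limn_sup (Omega_average R T (mset_val A) x) = 1 /\
            limn_inf (Omega_average R T (mset_val A) x) = 0}].
Proof.
(* the parity of n selects the upper or the lower limit *)
pose F n : set (measurable_sets mu) := often_sets T (odd n) n./2.
have oF n : open (F n) by exact: open_often_sets.
have dF n : dense (F n) by exact: dense_often_sets.
exists (\bigcap_n F n); split; first by exists F.
  exact: measurable_sets_Baire.
move=> A FA; have mA := mset_valP A.
have oA b k : often mu T k (side b (mset_val A)).
  have := FA (b + k.*2)%N I.
  by rewrite /F /often_sets /= half_bit_double oddD odd_double addbF; case: b.
have up := often_ae mpT (measurable_side true mA) (oA true).
have down := often_ae mpT (measurable_side false mA) (oA false).
apply: filterS2 up down => x /= up down; split.
  by apply: limn_sup_frequent => // n; exact: Omega_average_le1.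
apply: limn_inf_frequent => [n|k]; first exact: Omega_average_ge0.
have [N kN] := down k; rewrite Omega_averageC ?(leq_ltn_trans _ kN)//.
by rewrite ltrD2l ltrN2 => AN; exists N => //; rewrite add0r.
Qed.
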